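(* Let $\Gamma$ be a discrete group and let $\omega\colon\Gamma\times\Gamma\to\mathbf{R}$ be an arbitrary 1-bounded 2-cocycle. For $g\in\Gamma$ define $\|g\|_\omega=|\omega(g,\cdot)|_{\mathrm{osc}}$. Then the function $\|\cdot\|_\omega$ is a well defined (pseudo)metric on $\Gamma$. Moreover, if $\eta\colon\Gamma\to\mathbf{R}$ is a bounded 1-cochain, then $\|\cdot\|_\omega$ and $\|\cdot\|_{\omega+\delta\eta}$ are within finite distance, at most $2|\eta|_{\mathrm{osc}}$; that is, $\bigl|\|g\|_\omega-\|g\|_{\omega+\delta\eta}\bigr|\le 2|\eta|_{\mathrm{osc}}$ for all $g\in\Gamma$.
   Context: Cochains are nonhomogeneous with trivial real coefficients. A 2-cochain is a function $\omega\colon\Gamma\times\Gamma\to\mathbf{R}$; it is a cocycle if $\omega(g_2,g_3)-\omega(g_1g_2,g_3)+\omega(g_1,g_2g_3)-\omega(g_1,g_2)=0$ for all $g_1,g_2,g_3\in\Gamma$. It is 1-bounded if for each fixed $g_2\in\Gamma$ the function $g_1\mapsto\omega(g_1,g_2)$ is bounded. A 1-cochain is a function $\eta\colon\Gamma\to\mathbf{R}$, and $\delta\eta(g,h)=\eta(h)-\eta(gh)+\eta(g)$. For a bounded function $\psi\colon\Gamma\to\mathbf{R}$, $|\psi|_{\mathrm{osc}}=\sup_{h,h'\in\Gamma}|\psi(h)-\psi(h')|$; the notation $\omega(g,\cdot)$ means the function $h\mapsto\omega(g,h)$, so $\|g\|_\omega=\sup_{h,h'\in\Gamma}|\omega(g,h)-\omega(g,h')|$.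 Calling the one-variable function $\|\cdot\|_\omega$ a (pseudo)metric on $\Gamma$ means that it is a possibly degenerate length function (norm) on the group: symmetric, $\|g^{-1}\|_\omega=\|g\|_\omega$, and satisfying the triangle inequality $\|g_1g_2\|_\omega\le\|g_1\|_\omega+\|g_2\|_\omega$.
   Formalization: 1-boundedness in the first variable does not make the norm finite (it fails on the infinite dihedral group), so the norm may be +∞, is finite exactly when ω(g,·) is bounded, and the absolute-value bound is stated where it is finite, with one-sided bounds everywhere. *)

(* Defs.v *)
From HB Require Import structures.
From mathcomp Require Import all_boot all_order all_algebra.
From mathcomp Require Import all_classical all_reals all_analysis.

Set Implicit Arguments.
Unset Strict Implicit.
Unset Printing Implicit Defensive.

Import Order.TTheory GRing.Theory Num.Theory.
Import numFieldNormedType.Exports.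

Local Open Scope classical_set_scope.
Local Open Scope ring_scope.

Definition is_cocycle2 (R : realType) (G : groupType) (omega : G -> G -> R) :
    Prop :=
  forall g1 g2 g3 : G,
    omega g2 g3 - omega (g1 * g2)%g g3 + omega g1 (g2 * g3)%g - omega g1 g2 = 0.

Definition one_bounded (R : realType) (G : groupType) (omega : G -> G -> R) :
    Prop :=
  forall g2 : G, bounded_fun (fun g1 : G => omega g1 g2).

Definition coboundary1 (R : realType) (G : groupType) (eta : G -> R) :
    G -> G -> R :=
  fun g h => eta h - eta (g * h)%g + eta g.

(* The supremum is taken in the extended reals: boundedness of a cocycle in its
   first variable does not bound it in its second one.  For instance, on the
   infinite dihedral group, the coboundary of eta (n, e) := max n 0 is bounded
   in its first variable, since right translation by (m, f) moves eta by at
   most |m|, but left translation by the reflection (0, -1) moves it by an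
   unbounded amount, so that the oscillation at this reflection is +oo. *)
Definition osc (R : realType) (T : Type) (psi : T -> R) : \bar R :=
  ereal_sup (range (fun x : T * T => `|psi x.1 - psi x.2|%:E)).

Definition cocycle_norm (R : realType) (G : groupType) (omega : G -> G -> R)
    (g : G) : \bar R :=
  osc (omega g).

(* Possibly degenerate length functions, i.e., the functions N such that
   (g, h) |-> N (g^-1 * h) is a left-invariant (extended) pseudometric. *)
Definition is_length_function (R : realType) (G : groupType) (N : G -> \bar R) :
    Prop :=
  [/\ N 1%g = 0%E,
      forall g : G, (0 <= N g)%E,
      forall g : G, N (g^-1)%g = N g &
      forall g1 g2 : G, (N (g1 * g2)%g <= N g1 + N g2)%E].

(* Main.v *)
Require Import Defs.
From HB Require Import structures.
From mathcomp Require Import all_boot all_order all_algebra.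
From mathcomp Require Import all_classical all_reals all_analysis.
From mathcomp Require Import lra.

(** For fixed [g] the oscillation ignores the terms of the cocycle identity
    that are constant in the last variable.  Hence the identity says that, up to
    a constant, [omega (g1 * g2) h] is [omega g2 h + omega g1 (g2 * h)]
    ([cocycle2_diff]).  Reindexing [h] by [g2 * h] cannot increase an
    oscillation, so the triangle inequality is the subadditivity of oscillation.
    Taking [g1 = g2 = 1] shows that [omega 1] is constant, so that [1] has norm
    [0]; then [g1 = g^-1], [g2 = g] shows that the increments of [omega g] are
    opposite to increments of [omega g^-1], whence the symmetry.

    Adding the coboundary of [eta] changes the increment of [omega g] between
    [h] and [k] by one increment of [eta] between [h] and [k], and another one
    between [g * h] and [g * k], that is by at most twice the oscillation of
    [eta] ([coboundary1_diff_le]).  Two functions whose increments differ by at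
    most [c] have oscillations each at most the other plus [c] ([osc_perturb]).
    These two bounds hold also where the norms are infinite, and show that the
    norms are finite at the same elements; there they bound the distance
    ([lee_dist_fin]).  An oscillation is finite exactly when the function is
    bounded ([osc_fin_numP]). *)

Set Implicit Arguments.
Unset Strict Implicit.
Unset Printing Implicit Defensive.

Import Order.TTheory GRing.Theory Num.Theory.
Import numFieldNormedType.Exports.

Local Open Scope classical_set_scope.
Local Open Scope ring_scope.

Lemma le_osc (R : realType) (T : Type) (psi : T -> R) (x y : T) :
  (`|psi x - psi y|%:E <= osc psi)%E.
Proof. by apply: ereal_sup_ubound; exists (x, y). Qed.

Lemma osc_le (R : realType) (T : Type) (psi : T -> R) (M : \bar R) :
  (forall x y, (`|psi x - psi y|%:E <= M)%E) -> (osc psi <= M)%E.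
Proof. by move=> H; apply: ge_ereal_sup => _ [[x y] _ <-]; exact: H. Qed.

(** The point [x0] excludes the empty type, on which the oscillation is
    [-oo], the supremum of the empty set. *)
Lemma osc_ge0 (R : realType) (T : Type) (x0 : T) (psi : T -> R) :
  (0 <= osc psi)%E.
Proof. by apply: le_trans (le_osc psi x0 x0); rewrite lee_fin. Qed.

Lemma osc_fin_numP (R : realType) (T : Type) (x0 : T) (psi : T -> R) :
  osc psi \is a fin_num <-> bounded_fun psi.
Proof.
split=> [fin|[M [_ bndM]]].
- exists (`|psi x0| + fine (osc psi)); split; first exact: num_real.
  move=> M /ltW leM x _ /=; apply: le_trans leM.
  have : `|psi x - psi x0| <= fine (osc psi).
    by rewrite -lee_fin fineK //; exact: le_osc.
  by rewrite -lerBlDl; apply: le_trans; exact: lerB_dist.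
- rewrite ge0_fin_numE; last exact: osc_ge0.
  have {}bndM x : `|psi x| <= M + 1 by apply: bndM => //; rewrite ltrDl.
  apply: (@le_lt_trans _ _ ((M + 1) + (M + 1))%:E); last exact: ltry.
  apply: osc_le => x y; rewrite lee_fin.
  by apply: le_trans (ler_normB _ _) _; exact: lerD.
Qed.

Lemma osc_perturb (R : realType) (T : Type) (phi psi : T -> R) (c : \bar R) :
  (forall x y, (`|(phi x - phi y) - (psi x - psi y)|%:E <= c)%E) ->
  (osc phi <= osc psi + c)%E.
Proof.
move=> H; apply: osc_le => x y.
apply: le_trans (leeD (le_osc psi x y) (H x y)).
by rewrite -EFinD lee_fin -lerBlDl lerB_dist.
Qed.

(** Since [+oo - +oo] is [-oo], the bound on [`|a - b|] fails when both are
    infinite, although the one-sided bounds hold there; the latter carry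
    finiteness from [a] to [b]. *)
Lemma lee_dist_fin (R : realType) (a b : \bar R) (c : R) :
  (0 <= b)%E -> (a <= b + c%:E)%E -> (b <= a + c%:E)%E ->
  a \is a fin_num -> b \is a fin_num /\ (`|a - b| <= c%:E)%E.
Proof.
case: a => [a||] //; case: b => [b||] // _.
rewrite -!EFinD abse_EFin !lee_fin => ab ba _; split=> //.
by rewrite ler_norml; apply/andP; split; lra.
Qed.

(** Differences in the last variable cancel the term [omega g1 g2] of the
    cocycle identity, leaving a relation between increments only. *)
Lemma cocycle2_diff (R : realType) (G : groupType) (omega : G -> G -> R)
    (g1 g2 h k : G) : is_cocycle2 omega ->
  omega (g1 * g2)%g h - omega (g1 * g2)%g k =
  (omega g2 h - omega g2 k) + (omega g1 (g2 * h)%g - omega g1 (g2 * k)%g).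
Proof. by move=> cocy; have := cocy g1 g2 h; have := cocy g1 g2 k; lra. Qed.

Lemma cocycle2_1_diff (R : realType) (G : groupType) (omega : G -> G -> R)
    (h k : G) : is_cocycle2 omega -> omega 1%g h - omega 1%g k = 0.
Proof.
by move=> /(cocycle2_diff 1%g 1%g h k); rewrite !mul1g; lra.
Qed.

Lemma coboundary1_diff_le (R : realType) (G : groupType) (eta : G -> R)
    (g h k : G) :
  (`|coboundary1 eta g h - coboundary1 eta g k|%:E <= 2%:E * osc eta)%E.
Proof.
rewrite mule_natl mule2n.
apply: le_trans (leeD (le_osc eta h k) (le_osc eta (g * h)%g (g * k)%g)).
rewrite -EFinD lee_fin; apply: le_trans (ler_normB _ _).
suff -> : coboundary1 eta g h - coboundary1 eta g k =
  eta h - eta k - (eta (g * h)%g - eta (g * k)%g) by [].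
by rewrite /coboundary1; lra.
Qed.

Lemma cocycle_norm_length (R : realType) (G : groupType)
    (omega : G -> G -> R) :
  is_cocycle2 omega -> is_length_function (cocycle_norm omega).
Proof.
move=> cocy.
have normV_le g : (cocycle_norm omega g <= cocycle_norm omega g^-1%g)%E.
  apply: osc_le => h k.
  have := cocycle2_diff g^-1%g g h k cocy.
  rewrite mulVg (cocycle2_1_diff _ _ cocy) => /esym/eqP.
  by rewrite addr_eq0 => /eqP ->; rewrite normrN; exact: le_osc.
split=> [|g|g|g1 g2].
- apply/le_anti/andP; split; last exact: (osc_ge0 1%g).
  by apply: osc_le => h k; rewrite (cocycle2_1_diff _ _ cocy) normr0.
- exact: (osc_ge0 1%g).
- by apply/le_anti/andP; split=> //; rewrite -{2}[g]invgK.
- apply: osc_le => h k; rewrite (cocycle2_diff _ _ _ _ cocy) addrC.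
  apply: le_trans (leeD (le_osc _ (g2 * h)%g (g2 * k)%g) (le_osc _ h k)).
  by rewrite -EFinD lee_fin ler_normD.
Qed.

Theorem proposition4p3 (R : realType) (G : groupType) (omega : G -> G -> R)
    (omega_cocycle : is_cocycle2 omega) (omega_bounded : one_bounded omega) :
  [/\ is_length_function (cocycle_norm omega),
      forall g : G,
        cocycle_norm omega g \is a fin_num <-> bounded_fun (omega g) &
      forall eta : G -> R, bounded_fun eta ->
        let omega' := fun g h => omega g h + coboundary1 eta g h in
        osc eta \is a fin_num /\
        forall g : G,
          [/\ (cocycle_norm omega g <= cocycle_norm omega' g + 2%:E * osc eta)%E,
              (cocycle_norm omega' g <= cocycle_norm omega g + 2%:E * osc eta)%E &
              cocycle_norm omega g \is a fin_num ->
              cocycle_norm omega' g \is a fin_num /\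
              (`|cocycle_norm omega g - cocycle_norm omega' g|
                 <= 2%:E * osc eta)%E]].
Proof.
split=> [|g|eta eta_bnd omega'].
- exact: cocycle_norm_length.
- exact: (osc_fin_numP 1%g).
- have eta_fin : osc eta \is a fin_num by apply/(osc_fin_numP 1%g).
  have incr g h k : omega' g h - omega' g k - (omega g h - omega g k) =
      coboundary1 eta g h - coboundary1 eta g k by rewrite /omega'; lra.
  split=> // g.
  have le1 : (cocycle_norm omega g <= cocycle_norm omega' g + 2%:E * osc eta)%E.
    by apply: osc_perturb => h k; rewrite distrC incr; exact: coboundary1_diff_le.
  have le2 : (cocycle_norm omega' g <= cocycle_norm omega g + 2%:E * osc eta)%E.
    by apply: osc_perturb => h k; rewrite incr; exact: coboundary1_diff_le.
  split=> //; move: le1 le2; rewrite -(fineK eta_fin) -EFinM.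
  by apply: lee_dist_fin; exact: (osc_ge0 1%g).
Qed.
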